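(* Let $\mathcal{A}=\mathscr{A}(\mathbb{D})$ be the disk algebra. Let $f(z)=\left(\frac{z-z_0}{2}\right)$ for some $z_0\in\mathbb{C}$. Then $f$ is a topological divisor of zero in $\mathcal{A}$ if and only if $|z_0|=1$.
   Context: Let $\mathbb{D}=\{z\in\mathbb{C}:|z|<1\}$ and let $\bar{\mathbb{D}}$ be its closure. The disk algebra $\mathscr{A}(\mathbb{D})$ is the Banach algebra, under pointwise operations and the supremum norm, of all complex-valued functions continuous on $\bar{\mathbb{D}}$ and analytic in $\mathbb{D}$. An element $z$ of a Banach algebra $\mathcal{A}$ is called a topological divisor of zero if there exists a sequence $(z_n)_{n=1}^\infty$ in $\mathcal{A}$ such that $\|z_n\|=1$ for all $n\in\mathbb{N}$, and either $zz_n\to 0$ or $z_nz\to 0$ as $n\to\infty$. *)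

(* Defs.v *)
From Stdlib Require Import Reals Lra Lia List.
From Stdlib Require Import Classical ClassicalEpsilon FunctionalExtensionality ProofIrrelevance.
From Coquelicot Require Import Coquelicot.

Open Scope R_scope.

(** [AbsRing] is the library's structure of unital normed rings.  Completeness
    and multiplication by scalars play no role in the definition. *)

Definition topological_divisor_of_zero {A : AbsRing} (z : A) : Prop :=
  exists zn : nat -> A,
    (forall n : nat, abs (zn n) = 1) /\
    (filterlim (fun n => mult z (zn n)) eventually
       (locally (zero : AbsRing_UniformSpace A)) \/
     filterlim (fun n => mult (zn n) z) eventually
       (locally (zero : AbsRing_UniformSpace A))).

Record closed_disk : Type := Closed_disk
  { disk_val :> C; disk_le1 : Cmod disk_val <= 1 }.

Lemma Cmod_0_le1 : Cmod 0 <= 1.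
Proof. rewrite Cmod_0; lra. Qed.

Definition closed_disk_ball (x : closed_disk) (e : R) (y : closed_disk) : Prop :=
  ball (x : C) e (y : C).

Definition closed_disk_UniformSpace_mixin : UniformSpace.mixin_of closed_disk :=
  UniformSpace.Mixin closed_disk (Closed_disk 0 Cmod_0_le1) closed_disk_ball
    (fun x e => ball_center (x : C) e)
    (fun x y e => ball_sym (x : C) (y : C) e)
    (fun x y z e1 e2 => ball_triangle (x : C) (y : C) (z : C) e1 e2).

Canonical closed_disk_UniformSpace : UniformSpace :=
  UniformSpace.Pack closed_disk closed_disk_UniformSpace_mixin closed_disk.

(** Near an interior point [c], quantifying over [w : closed_disk] is no
    restriction, since the radius [r] can be shrunk. *)
Definition analytic_at (f : closed_disk -> C) (c : closed_disk) : Prop :=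
  exists (a : nat -> C) (r : posreal),
    forall w : closed_disk,
      Cmod (w - c) < r -> is_pseries a (w - c)%C (f w).

Record disk_function : Type := Disk_function
  { disk_fun :> closed_disk -> C;
    disk_fun_continuous : forall z : closed_disk, continuous disk_fun z;
    disk_fun_analytic :
      forall z : closed_disk, Cmod z < 1 -> analytic_at disk_fun z }.

Definition sup_norm (f : closed_disk -> C) : R :=
  real (Lub_Rbar (fun r : R => exists z : closed_disk, r = Cmod (f z))).

Lemma disk_function_ext (f g : disk_function) : (forall z, f z = g z) -> f = g.
Proof.
  destruct f as [f cf af], g as [g cg ag]; simpl; intros E.
  assert (f = g) by (apply functional_extensionality, E); subst g.
  f_equal; apply proof_irrelevance.
Qed.

Lemma Cmod_le_abs (x y : R) : Cmod (x, y) <= Rabs x + Rabs y.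
Proof.
  replace ((x, y) : C) with (RtoC x + RtoC y * Ci)%C
    by (apply injective_projections; simpl; ring).
  eapply Rle_trans; [apply Cmod_triangle|].
  rewrite Cmod_mult, Cmod_Ci, !Cmod_R; lra.
Qed.

Lemma disk_function_loc_bounded (f : closed_disk -> C) (p : C) :
  (forall z : closed_disk, continuous f z) ->
  exists dM : posreal * R, forall w : closed_disk,
    Rabs (Re w - Re p) < fst dM -> Rabs (Im w - Im p) < fst dM ->
    Cmod (f w) <= snd dM.
Proof.
  intros cf.
  destruct (Rle_lt_dec (Cmod p) 1) as [Hp|Hp].
  - set (z := Closed_disk p Hp).
    pose proof (proj1 (filterlim_locally f (f z)) (cf z) (mkposreal 1 Rlt_0_1))
      as [d Hd].
    exists (d, Cmod (f z) + 2); simpl; intros w H1 H2.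
    destruct (Hd w) as [B1 B2]; [split; assumption|].
    simpl in B1, B2.
    unfold ball in B1, B2; simpl in B1, B2.
    unfold AbsRing_ball, abs, minus, plus, opp in B1, B2; simpl in B1, B2.
    replace (f w) with (f z + (f w - f z))%C by ring.
    eapply Rle_trans; [apply Cmod_triangle|].
    apply Rplus_le_compat_l.
    eapply Rle_trans; [apply Cmod_le_abs|].
    apply Rle_trans with (1 + 1); [apply Rplus_le_compat; left; assumption | lra].
  - assert (Hd : 0 < (Cmod p - 1) / 2) by lra.
    exists (mkposreal _ Hd, 0); simpl; intros w H1 H2.
    exfalso.
    pose proof (disk_le1 w) as Hw.
    assert (Cmod p <= Cmod w + Cmod (w - p)).
    { replace (Cmod (w - p)) with (Cmod (- (w - p))) by apply Cmod_opp.
      replace (p : C) with (w + - (w - p))%C at 1 by ring.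
      apply Cmod_triangle. }
    assert (Cmod (w - p) <= Rabs (Re w - Re p) + Rabs (Im w - Im p))
      by apply Cmod_le_abs.
    lra.
Qed.

Lemma disk_function_bounded (f : closed_disk -> C) :
  (forall z : closed_disk, continuous f z) ->
  exists M : R, forall z : closed_disk, Cmod (f z) <= M.
Proof.
  intros cf.
  set (dM := fun p => proj1_sig (constructive_indefinite_description _
                        (disk_function_loc_bounded f p cf))).
  assert (HdM : forall (p : C) (w : closed_disk),
    Rabs (Re w - Re p) < fst (dM p) -> Rabs (Im w - Im p) < fst (dM p) ->
    Cmod (f w) <= snd (dM p)).
  { intros p; unfold dM.
    destruct (constructive_indefinite_description _ _) as [q Hq]; exact Hq. }
  set (pt := fun t : Compactness.Tn 2 R => (fst t, fst (snd t))).
  apply NNPP; intros Hn.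
  apply (compactness_list 2 (-1, (-1, tt)) (1, (1, tt)) (fun t => fst (dM (pt t)))).
  intros [l Hl]; apply Hn.
  assert (Hmax : exists M, forall t, In t l -> snd (dM (pt t)) <= M).
  { clear; induction l as [|t l [M HM]].
    - exists 0; intros t [].
    - exists (Rmax (snd (dM (pt t))) M); intros s [<-|Hs].
      + apply Rmax_l.
      + eapply Rle_trans; [apply HM, Hs | apply Rmax_r]. }
  destruct Hmax as [M HM]; exists M; intros z.
  assert (Hz : Rabs (Re z) <= 1 /\ Rabs (Im z) <= 1).
  { pose proof (Rmax_Cmod (z : C)) as Hm; pose proof (disk_le1 z).
    change (Rmax (Rabs (Re z)) (Rabs (Im z)) <= Cmod z) in Hm.
    pose proof (Rmax_l (Rabs (Re z)) (Rabs (Im z))).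
    pose proof (Rmax_r (Rabs (Re z)) (Rabs (Im z))). lra. }
  destruct Hz as [Hz1 Hz2]; apply Rabs_le_between in Hz1, Hz2.
  destruct (Hl (Re z, (Im z, tt))) as [[t1 [t2 []]] [Ht [_ Hc]]].
  { simpl; tauto. }
  simpl in Hc.
  eapply Rle_trans; [apply (HdM (t1, t2)); simpl; apply Hc | apply (HM _ Ht)].
Qed.

Lemma sup_norm_ub (f : disk_function) (z : closed_disk) :
  Cmod (f z) <= sup_norm f.
Proof.
  unfold sup_norm.
  destruct (Lub_Rbar_correct (fun r => exists z, r = Cmod (f z))) as [ub lub].
  destruct (disk_function_bounded f (disk_fun_continuous f)) as [M HM].
  assert (HubM : is_ub_Rbar (fun r => exists z, r = Cmod (f z)) M)
    by (intros r [y ->]; apply HM).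
  specialize (lub _ HubM).
  pose proof (ub _ (ex_intro _ z eq_refl)) as Hz.
  destruct (Lub_Rbar _) as [s| |]; simpl in *; tauto.
Qed.

Lemma sup_norm_le (f : closed_disk -> C) (M : R) :
  (forall z, Cmod (f z) <= M) -> sup_norm f <= M.
Proof.
  intros HM; unfold sup_norm.
  destruct (Lub_Rbar_correct (fun r => exists z, r = Cmod (f z))) as [ub lub].
  assert (HubM : is_ub_Rbar (fun r => exists z, r = Cmod (f z)) M)
    by (intros r [y ->]; apply HM).
  specialize (lub _ HubM).
  pose proof (ub _ (ex_intro _ (Closed_disk 0 Cmod_0_le1) eq_refl)) as Hz.
  destruct (Lub_Rbar _) as [s| |]; simpl in *; tauto.
Qed.

Lemma sup_norm_ge0 (f : disk_function) : 0 <= sup_norm f.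
Proof.
  eapply Rle_trans; [apply Cmod_ge_0 | apply (sup_norm_ub f (Closed_disk 0 Cmod_0_le1))].
Qed.

Lemma sup_norm_const (f : closed_disk -> C) (r : R) :
  (forall z, Cmod (f z) = r) -> sup_norm f = r.
Proof.
  intros H; unfold sup_norm.
  rewrite (is_lub_Rbar_unique _ r); [reflexivity|]; split.
  - intros x [z ->]; rewrite H; apply Rle_refl.
  - intros b Hb; apply Hb; exists (Closed_disk 0 Cmod_0_le1); symmetry; apply H.
Qed.

Lemma analytic_at_const (c : C) (z : closed_disk) : analytic_at (fun _ => c) z.
Proof.
  exists (fun n => match n with O => c | S _ => 0%C end), (mkposreal 1 Rlt_0_1).
  intros w _; unfold is_pseries.
  apply filterlim_ext with (fun _ => c); [|apply filterlim_const].
  intros n; induction n as [|n IH].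
  - rewrite sum_O; simpl; unfold scal; simpl; unfold mult, one; simpl; ring.
  - rewrite sum_Sn, <- IH; unfold scal; simpl; unfold mult, plus; simpl; ring.
Qed.

Lemma analytic_at_plus (f g : closed_disk -> C) (z : closed_disk) :
  analytic_at f z -> analytic_at g z -> analytic_at (fun w => f w + g w)%C z.
Proof.
  intros (a & r & Ha) (b & s & Hb).
  exists (PS_plus a b), (mkposreal _ (Rmin_pos _ _ (cond_pos r) (cond_pos s))).
  simpl; intros w Hw.
  apply (@is_pseries_plus C_AbsRing C_NormedModule).
  - apply Ha; eapply Rlt_le_trans; [apply Hw | apply Rmin_l].
  - apply Hb; eapply Rlt_le_trans; [apply Hw | apply Rmin_r].
Qed.

Lemma analytic_at_opp (f : closed_disk -> C) (z : closed_disk) :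
  analytic_at f z -> analytic_at (fun w => - f w)%C z.
Proof.
  intros (a & r & Ha); exists (PS_opp a), r; intros w Hw.
  apply (@is_pseries_opp C_AbsRing C_NormedModule), Ha, Hw.
Qed.

Lemma sum_n_C (u : nat -> C) (n : nat) :
  sum_n u n = (sum_n (fun k => Re (u k)) n, sum_n (fun k => Im (u k)) n).
Proof.
  induction n as [|n IH].
  - rewrite !sum_O; apply surjective_pairing.
  - rewrite !sum_Sn, IH; reflexivity.
Qed.

Lemma is_series_C (u : nat -> C) (l : C) :
  is_series u l <->
  is_series (fun k => Re (u k)) (Re l) /\ is_series (fun k => Im (u k)) (Im l).
Proof.
  unfold is_series; split.
  - intros H.
    split; apply filterlim_locally; intros eps;
      pose proof (proj1 (filterlim_locally (sum_n u) (l : C_UniformSpace)) H eps) as He;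
      revert He; apply filter_imp; intros n; rewrite sum_n_C; intros [H1 H2];
      assumption.
  - intros [H1 H2].
    apply (proj2 (filterlim_locally (sum_n u) (l : C_UniformSpace))); intros eps.
    pose proof (filter_and _ _
      (proj1 (filterlim_locally _ _) H1 eps) (proj1 (filterlim_locally _ _) H2 eps)) as He.
    revert He; apply filter_imp; intros n [E1 E2]; rewrite sum_n_C; split; assumption.
Qed.

Lemma im_le_Cmod (c : C) : Rabs (Im c) <= Cmod c.
Proof. eapply Rle_trans; [apply Rmax_r | apply Rmax_Cmod]. Qed.

Lemma sum_n_minus (a b : nat -> R) (n : nat) :
  minus (sum_n a n) (sum_n b n) = sum_n (fun k => a k - b k) n.
Proof.
  induction n as [|n IH].
  - rewrite !sum_O; reflexivity.
  - rewrite !sum_Sn, <- IH; unfold minus, plus, opp; simpl; ring.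
Qed.

Lemma is_series_C_mult (u v : nat -> C) (lu lv : C) :
  is_series u lu -> is_series v lv ->
  ex_series (fun n => Cmod (u n)) -> ex_series (fun n => Cmod (v n)) ->
  is_series (fun n => sum_n (fun k => u k * v (n - k)%nat)%C n) (lu * lv)%C.
Proof.
  intros Hu Hv Au Av.
  apply is_series_C in Hu; apply is_series_C in Hv.
  destruct Hu as [Hu1 Hu2], Hv as [Hv1 Hv2].
  assert (AR : forall w : nat -> C, ex_series (fun n => Cmod (w n)) ->
    ex_series (fun n => Rabs (Re (w n))) /\ ex_series (fun n => Rabs (Im (w n)))).
  { intros w Hw; split; refine (ex_series_le _ _ _ Hw); intros n;
      unfold norm; simpl; unfold abs; simpl; rewrite Rabs_Rabsolu;
      [apply re_le_Cmod | apply im_le_Cmod]. }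
  destruct (AR _ Au) as [Au1 Au2], (AR _ Av) as [Av1 Av2].
  apply is_series_C; split.
  - pose proof (is_series_minus _ _ _ _
      (is_series_mult _ _ _ _ Hu1 Hv1 Au1 Av1)
      (is_series_mult _ _ _ _ Hu2 Hv2 Au2 Av2)) as H.
    refine (is_series_ext _ _ _ _ H); intros n.
    rewrite sum_n_C; simpl.
    rewrite <- !sum_n_Reals.
    etransitivity; [apply (sum_n_minus (fun k => Re (u k) * Re (v (n - k)%nat))
                             (fun k => Im (u k) * Im (v (n - k)%nat)))|].
    apply sum_n_ext; intros k; reflexivity.
  - pose proof (is_series_plus _ _ _ _
      (is_series_mult _ _ _ _ Hu1 Hv2 Au1 Av2)
      (is_series_mult _ _ _ _ Hu2 Hv1 Au2 Av1)) as H.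
    refine (is_series_ext _ _ _ _ H); intros n.
    rewrite sum_n_C; simpl.
    rewrite <- !sum_n_Reals.
    rewrite <- (sum_n_plus (G := R_AbelianGroup)).
    apply sum_n_ext; intros k; reflexivity.
Qed.

Lemma Cmod_pow_n (t : C) (n : nat) : Cmod (pow_n (K := C_Ring) t n) = Cmod t ^ n.
Proof.
  induction n as [|n IH]; simpl.
  - apply Cmod_1.
  - unfold mult; simpl; rewrite Cmod_mult, IH; reflexivity.
Qed.

Lemma pseries_C_abs (a : nat -> C) (rho t : C) (l : C) :
  is_pseries a rho l -> Cmod t < Cmod rho ->
  ex_series (fun n => Cmod (pow_n (K := C_Ring) t n * a n)%C).
Proof.
  intros H Ht.
  assert (H0 : 0 < Cmod rho) by (pose proof (Cmod_ge_0 t); lra).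
  assert (HM : exists M, forall n, Cmod (a n) * Cmod rho ^ n <= M).
  { pose proof (ex_series_lim_0 _ (ex_intro _ _ (proj1 (proj1 (is_series_C _ _) H)))) as L1.
    pose proof (ex_series_lim_0 _ (ex_intro _ _ (proj2 (proj1 (is_series_C _ _) H)))) as L2.
    destruct (filterlim_bounded (K := R_AbsRing) (V := R_NormedModule) _
      (ex_intro _ 0 L1)) as [M1 HM1].
    destruct (filterlim_bounded (K := R_AbsRing) (V := R_NormedModule) _
      (ex_intro _ 0 L2)) as [M2 HM2].
    exists (M1 + M2); intros n.
    rewrite <- Cmod_pow_n, Rmult_comm, <- Cmod_mult.
    specialize (HM1 n); specialize (HM2 n).
    eapply Rle_trans; [|apply Rplus_le_compat; [apply HM1 | apply HM2]].
    rewrite (surjective_pairing (_ * _)%C); apply Cmod_le_abs. }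
  destruct HM as [M HM].
  assert (HG : ex_series (fun n => scal M ((Cmod t / Cmod rho) ^ n))).
  { apply (ex_series_scal (V := R_NormedModule)), ex_series_geom.
    rewrite Rabs_pos_eq.
    - apply Rlt_div_l; [assumption | lra].
    - apply Rdiv_le_0_compat; [apply Cmod_ge_0 | assumption]. }
  refine (ex_series_le _ _ _ HG); intros n.
  unfold norm, scal; simpl; unfold abs, mult; simpl.
  rewrite Rabs_pos_eq by apply Cmod_ge_0.
  rewrite Cmod_mult, Cmod_pow_n.
  replace (Cmod t ^ n * Cmod (a n))
    with ((Cmod (a n) * Cmod rho ^ n) * (Cmod t / Cmod rho) ^ n).
  - apply Rmult_le_compat_r; [|apply HM].
    apply pow_le, Rdiv_le_0_compat; [apply Cmod_ge_0 | assumption].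
  - rewrite Rmult_assoc, <- Rpow_mult_distr.
    replace (Cmod rho * (Cmod t / Cmod rho)) with (Cmod t) by (field; lra).
    ring.
Qed.

Lemma analytic_at_mult (f g : closed_disk -> C) (z : closed_disk) :
  Cmod z < 1 ->
  analytic_at f z -> analytic_at g z -> analytic_at (fun w => f w * g w)%C z.
Proof.
  intros Hz (a & r & Ha) (b & s & Hb).
  exists (fun n => sum_n (fun k => a k * b (n - k)%nat)%C n).
  assert (Hq : 0 < Rmin (1 - Cmod z) (Rmin r s))
    by (repeat apply Rmin_pos; try apply cond_pos; lra).
  set (q := Rmin _ _) in Hq.
  assert (Hq1 : q <= 1 - Cmod z) by apply Rmin_l.
  assert (Hq2 : q <= r) by (eapply Rle_trans; [apply Rmin_r | apply Rmin_l]).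
  assert (Hq3 : q <= s) by (eapply Rle_trans; [apply Rmin_r | apply Rmin_r]).
  exists (mkposreal q Hq); simpl; intros w Hw.
  pose proof (Cmod_ge_0 (w - z)%C) as Hw0.
  set (rho := (Cmod (w - z) + q) / 2).
  assert (Hrho : Cmod (RtoC rho) = rho)
    by (rewrite Cmod_R; apply Rabs_pos_eq; unfold rho; lra).
  assert (Hp : Cmod (z + rho) <= 1).
  { eapply Rle_trans; [apply Cmod_triangle | rewrite Hrho; unfold rho; lra]. }
  set (p := Closed_disk (z + rho)%C Hp).
  assert (Ep : (p - z = rho)%C) by (simpl; ring).
  assert (Hpr : Cmod (p - z) < q) by (rewrite Ep, Hrho; unfold rho; lra).
  assert (Htr : Cmod (w - z) < Cmod (RtoC rho)) by (rewrite Hrho; unfold rho; lra).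
  pose proof (Ha w ltac:(lra)) as Ha1. pose proof (Hb w ltac:(lra)) as Hb1.
  pose proof (Ha p ltac:(lra)) as Ha2. pose proof (Hb p ltac:(lra)) as Hb2.
  rewrite Ep in Ha2, Hb2.
  pose proof (is_series_C_mult _ _ _ _ Ha1 Hb1
    (pseries_C_abs _ _ _ _ Ha2 Htr) (pseries_C_abs _ _ _ _ Hb2 Htr)) as H.
  unfold is_pseries.
  refine (is_series_ext _ _ _ _ H); intros n.
  rewrite <- (sum_n_scal_l (V := C_NormedModule)).
  apply sum_n_ext_loc; intros k Hk.
  assert (E : pow_n (K := C_Ring) (w - z)%C n
            = mult (pow_n (w - z)%C k) (pow_n (w - z)%C (n - k)))
    by (rewrite <- pow_n_plus; f_equal; lia).
  change ((pow_n (K := C_Ring) (w - z) k * a k)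
            * (pow_n (K := C_Ring) (w - z) (n - k)%nat * b (n - k)%nat)
          = pow_n (K := C_Ring) (w - z) n * (a k * b (n - k)%nat))%C.
  rewrite E.
  unfold mult; simpl; ring.
Qed.

Lemma analytic_at_id (z : closed_disk) : analytic_at (fun w => w) z.
Proof.
  exists (fun n => match n with O => (z : C) | S O => 1%C | _ => 0%C end),
    (mkposreal 1 Rlt_0_1).
  intros w _; unfold is_pseries.
  apply filterlim_ext_loc with (fun _ => (w : C)); [|apply filterlim_const].
  exists 1%nat; intros n Hn; induction Hn as [|n Hn IH].
  - rewrite sum_Sn, sum_O; unfold scal; simpl; unfold mult, plus, one; simpl; ring.
  - rewrite sum_Sn, <- IH; destruct n; [lia|].
    unfold scal; simpl; unfold mult, plus; simpl; ring.
Qed.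

Definition disk_const (c : C) : disk_function :=
  Disk_function (fun _ => c)
    (fun z => continuous_const c z)
    (fun z _ => analytic_at_const c z).

Lemma disk_id_continuous (z : closed_disk) : continuous (fun w : closed_disk => (w : C)) z.
Proof.
  apply filterlim_locally; intros eps; exists eps; intros y Hy; exact Hy.
Qed.

Definition disk_id : disk_function :=
  Disk_function (fun w => w) disk_id_continuous (fun z _ => analytic_at_id z).

Definition disk_plus (f g : disk_function) : disk_function :=
  Disk_function (fun z => f z + g z)%C
    (fun z => continuous_plus (V := C_NormedModule) f g z
                (disk_fun_continuous f z) (disk_fun_continuous g z))
    (fun z Hz => analytic_at_plus f g z
                (disk_fun_analytic f z Hz) (disk_fun_analytic g z Hz)).

Definition disk_opp (f : disk_function) : disk_function :=
  Disk_function (fun z => - f z)%C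
    (fun z => continuous_opp (V := C_NormedModule) f z (disk_fun_continuous f z))
    (fun z Hz => analytic_at_opp f z (disk_fun_analytic f z Hz)).

Lemma disk_mult_continuous (f g : disk_function) (z : closed_disk) :
  continuous (fun w => f w * g w)%C z.
Proof.
  apply (@continuous_scal _ C_AbsRing C_NormedModule f g z);
    [|exact (disk_fun_continuous g z)].
  intros P HP; apply (disk_fun_continuous f z), locally_C, HP.
Qed.

Definition disk_mult (f g : disk_function) : disk_function :=
  Disk_function (fun z => f z * g z)%C
    (disk_mult_continuous f g)
    (fun z Hz => analytic_at_mult f g z Hz
                (disk_fun_analytic f z Hz) (disk_fun_analytic g z Hz)).

Ltac disk_ext := intros; apply disk_function_ext; intros; simpl; ring.

Definition disk_AbelianMonoid_mixin : AbelianMonoid.mixin_of disk_function.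
Proof.
  apply (AbelianMonoid.Mixin _ disk_plus (disk_const 0)); disk_ext.
Defined.

Canonical disk_AbelianMonoid : AbelianMonoid :=
  AbelianMonoid.Pack disk_function disk_AbelianMonoid_mixin disk_function.

Definition disk_AbelianGroup_mixin : AbelianGroup.mixin_of disk_AbelianMonoid.
Proof.
  apply (AbelianGroup.Mixin _ disk_opp); disk_ext.
Defined.

Canonical disk_AbelianGroup : AbelianGroup :=
  AbelianGroup.Pack disk_function
    (AbelianGroup.Class _ disk_AbelianMonoid_mixin disk_AbelianGroup_mixin)
    disk_function.

Definition disk_Ring_mixin : Ring.mixin_of disk_AbelianGroup.
Proof.
  apply (Ring.Mixin _ disk_mult (disk_const 1)); disk_ext.
Defined.

Canonical disk_Ring : Ring :=
  Ring.Pack disk_function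
    (Ring.Class _ (AbelianGroup.class disk_AbelianGroup) disk_Ring_mixin)
    disk_function.

Definition disk_AbsRing_mixin : AbsRing.mixin_of disk_Ring.
Proof.
  apply (AbsRing.Mixin disk_Ring (fun f : disk_function => sup_norm f)).
  - apply sup_norm_const; intros z; apply Cmod_0.
  - apply sup_norm_const; intros z; apply Cmod_m1.
  - intros f g; apply sup_norm_le; intros z; simpl.
    eapply Rle_trans; [apply Cmod_triangle|].
    apply Rplus_le_compat; apply sup_norm_ub.
  - intros f g; apply sup_norm_le; intros z; simpl.
    rewrite Cmod_mult.
    apply Rmult_le_compat; try apply Cmod_ge_0; apply sup_norm_ub.
  - intros f Hf; apply disk_function_ext; intros z.
    apply Cmod_eq_0, Rle_antisym; [|apply Cmod_ge_0].
    rewrite <- Hf; apply sup_norm_ub.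
Defined.

Canonical disk_algebra : AbsRing :=
  AbsRing.Pack disk_function
    (AbsRing.Class _ (Ring.class disk_Ring) disk_AbsRing_mixin)
    disk_function.

Lemma half_shift_continuous (z0 : C) (z : closed_disk) :
  continuous (fun w : closed_disk => (w - z0) / 2)%C z.
Proof.
  exact (disk_fun_continuous
    (disk_mult (disk_plus disk_id (disk_const (- z0))) (disk_const (/ 2))) z).
Qed.

Lemma half_shift_analytic (z0 : C) (z : closed_disk) :
  Cmod z < 1 -> analytic_at (fun w => (w - z0) / 2)%C z.
Proof.
  exact (disk_fun_analytic
    (disk_mult (disk_plus disk_id (disk_const (- z0))) (disk_const (/ 2))) z).
Qed.

Definition half_shift (z0 : C) : disk_algebra :=
  Disk_function (fun z => (z - z0) / 2)%C
    (half_shift_continuous z0) (half_shift_analytic z0).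

(* Main.v *)
Require Import Defs.
From Stdlib Require Import Reals Lra Lia Classical.
From Coquelicot Require Import Coquelicot.
Open Scope R_scope.

(** Write [f] for the function [w |-> (w - z0) / 2].

    If [Cmod z0 = 1], then [q w = (w + z0) / 2] is a peak function at [z0]:
    the parallelogram identity gives [|f w|^2 + |q w|^2 <= 1] on the disk, and
    [q z0 = z0].  So the powers of [q] have norm 1, and
    [|f q^n|^2 <= y^n (1 - y)] with [y = |q|^2], which is at most
    [1 / (n + 1)].  Hence [f q^n] tends to 0 ([sup_norm_peak_pow],
    [half_shift_mul_peak_pow_le]).

    If [Cmod z0 <> 1], then [|f| >= |1 - |z0|| / 2 > 0] on the unit circle.  By
    the maximum principle the norm of an element of the disk algebra is
    controlled by its values on the circle, so multiplication by [f] is bounded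
    below ([half_shift_bounded_below]) and [f] is not a topological divisor of
    zero.  This treats [|z0| < 1] and [|z0| > 1] together.

    The maximum principle ([disk_maximum_principle]) is obtained without
    integration.  For [eps > 0], the continuous function
    [|g w| + eps |w|^2] attains its maximum on the closed disk, and this cannot
    happen at an interior point [p]: summing over the four points
    [p + h], [p - h], [p + ih], [p - ih] cancels the terms of degree 1 and 2 in
    the power series of [g], so the values of [|g|] sum to at least
    [4 |g p| - O(h^3)], while the values of [eps |w|^2] sum to
    [4 eps |p|^2 + 4 eps h^2], and the gain [4 eps h^2] wins for small [h]. *)

(** * Extreme values on the closed disk *)

Lemma continuous_RtoC (u : closed_disk -> R) (z : closed_disk) :
  continuous u z -> continuous (fun w => RtoC (u w)) z.
Proof.
  intros cu.
  apply (proj2 (filterlim_locally (fun w => RtoC (u w)) (RtoC (u z) : C_UniformSpace))).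
  intros eps.
  generalize (proj1 (filterlim_locally u (u z)) cu eps).
  apply filter_imp; intros w Hw; split; [exact Hw | apply ball_center].
Qed.

Lemma continuous_Cmod (g : closed_disk -> C) (z : closed_disk) :
  continuous g z -> continuous (fun w => Cmod (g w)) z.
Proof.
  intros cg.
  apply (continuous_comp g Cmod z cg).
  exact (filterlim_norm (V := C_NormedModule) (g z)).
Qed.

Lemma disk_real_bounded (u : closed_disk -> R) :
  (forall z, continuous u z) -> exists B, forall z, Rabs (u z) <= B.
Proof.
  intros cu.
  destruct (disk_function_bounded (fun w => RtoC (u w))) as [B HB].
  - intros z; apply continuous_RtoC, cu.
  - exists B; intros z; rewrite <- Cmod_R; apply HB.
Qed.

(** If the supremum [M] of [u] were not attained, [1 / (M - u)] would be
    continuous, hence bounded by some [K], and [M - 1 / K] would be a smaller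
    upper bound of [u]. *)
Lemma disk_max_attained (u : closed_disk -> R) :
  (forall z, continuous u z) -> exists p, forall z, u z <= u p.
Proof.
  intros cu.
  destruct (disk_real_bounded u cu) as [B HB].
  destruct (completeness (fun r => exists z, r = u z)) as [M [ub lub]].
  - exists B; intros r [z ->].
    eapply Rle_trans; [apply Rle_abs | apply HB].
  - exists (u (Closed_disk 0 Cmod_0_le1)); eexists; reflexivity.
  - assert (HM : forall z, u z <= M) by (intros z; apply ub; exists z; reflexivity).
    apply NNPP; intros Hn.
    assert (Hlt : forall z, u z < M).
    { intros z; destruct (Rle_lt_or_eq_dec _ _ (HM z)) as [H|H]; [exact H|].
      exfalso; apply Hn; exists z; rewrite H; exact HM. }
    destruct (disk_real_bounded (fun z => / (M - u z))) as [K HK].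
    { intros z.
      apply (continuous_comp (fun z => M - u z) Rinv z).
      - apply (continuous_minus (V := R_NormedModule) (fun _ => M) u z);
          [apply continuous_const | apply cu].
      - apply continuous_Rinv; specialize (Hlt z); lra. }
    assert (HK0 : 0 < K).
    { eapply Rlt_le_trans; [|apply (HK (Closed_disk 0 Cmod_0_le1))].
      specialize (Hlt (Closed_disk 0 Cmod_0_le1)).
      apply Rabs_pos_lt, Rinv_neq_0_compat; lra. }
    assert (M <= M - / K); [|pose proof (Rinv_0_lt_compat _ HK0); lra].
    apply lub; intros r [z ->].
    specialize (Hlt z); specialize (HK z).
    rewrite Rabs_pos_eq in HK by (left; apply Rinv_0_lt_compat; lra).
    apply Rinv_le_contravar in HK; [|apply Rinv_0_lt_compat; lra].
    rewrite Rinv_inv in HK; lra.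
Qed.

(** * The maximum principle *)

Lemma Cmod_series_le (c : nat -> C) (d : nat -> R) (l : C) (S : R) :
  is_series c l -> is_series d S -> (forall n, Cmod (c n) <= d n) -> Cmod l <= S.
Proof.
  intros Hc Hd Hle.
  refine (filterlim_le (F := eventually) (fun n => Cmod (sum_n c n)) (sum_n d) (Cmod l) S _ _ Hd).
  - apply filter_forall; intros n.
    eapply Rle_trans; [exact (norm_sum_n_m (V := C_NormedModule) c 0 n)|].
    apply sum_n_m_le; exact Hle.
  - eapply filterlim_comp; [exact Hc | exact (filterlim_norm (V := C_NormedModule) l)].
Qed.

(** With [s] inside the disk of convergence and [|h| <= s], each term of degree
    [n >= 3] satisfies [|a_n h^n| <= (|h| / s)^3 |a_n| s^n], so the remainder is
    at most [(|h| / s)^3] times a convergent series that does not depend on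
    [h]. *)
Lemma analytic_taylor2 (g : closed_disk -> C) (p : closed_disk) :
  Cmod p < 1 -> analytic_at g p ->
  exists (a1 a2 : C) (K s : R), 0 < s /\ 0 <= K /\
    forall w : closed_disk, Cmod (w - p) <= s ->
      Cmod (g w - (g p + a1 * (w - p) + a2 * ((w - p) * (w - p))))%C
        <= K * Cmod (w - p) ^ 3.
Proof.
  intros Hp (a & r & Ha).
  assert (Ha0 : g p = a 0%nat).
  { pose proof (Ha p) as H.
    replace (p - p)%C with (zero : C) in H by (change (zero : C) with (RtoC 0); ring).
    change (zero : C) with (RtoC 0) in H; rewrite Cmod_0 in H.
    specialize (H (cond_pos r)).
    apply (filterlim_locally_unique (F := eventually) _ _ _ H).
    exact (is_pseries_0 (K := C_AbsRing) (V := C_NormedModule) a). }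
  (* The factor 1/2 makes [rho] strictly less than the radius [r]; the other
     bound keeps [p + rho] in the closed disk, where the series is known to
     converge. *)
  set (rho := Rmin (1 - Cmod p) (r / 2)).
  assert (Hr0 : 0 < rho)
    by (apply Rmin_pos; [lra | pose proof (cond_pos r); lra]).
  assert (Hr1 : rho <= 1 - Cmod p) by apply Rmin_l.
  assert (Hr2 : rho < r)
    by (eapply Rle_lt_trans; [apply Rmin_r | pose proof (cond_pos r); lra]).
  assert (Hrho : Cmod rho = rho) by (rewrite Cmod_R; apply Rabs_pos_eq; lra).
  assert (Hq : Cmod (p + rho) <= 1)
    by (eapply Rle_trans; [apply Cmod_triangle | lra]).
  pose proof (Ha (Closed_disk _ Hq)) as Hser; simpl in Hser.
  replace (p + rho - p)%C with (RtoC rho) in Hser by ring.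
  specialize (Hser ltac:(lra)).
  set (s := rho / 2).
  assert (Hs : 0 < s) by (unfold s; lra).
  assert (Cs : Cmod s = s) by (rewrite Cmod_R; apply Rabs_pos_eq; lra).
  destruct (pseries_C_abs a rho s _ Hser) as [T HT];
    [rewrite Cs, Hrho; unfold s; lra|].
  assert (HT3 : ex_series (fun n => Cmod (pow_n (K := C_Ring) (RtoC s) (3 + n) * a (3 + n)%nat)%C)).
  { apply (ex_series_incr_n (V := R_NormedModule) (fun n => Cmod (pow_n (K := C_Ring) (RtoC s) n * a n)%C) 3).
    exists T; exact HT. }
  destruct HT3 as [T3 HT3].
  assert (HT30 : 0 <= T3).
  { rewrite <- Cmod_0.
    eapply (Cmod_series_le (fun _ => zero)); [|exact HT3|].
    - apply filterlim_ext with (fun _ => (zero : C)); [|apply filterlim_const].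
      intros n; unfold sum_n; symmetry; apply (sum_n_m_const_zero (G := C_AbelianGroup)).
    - intros n; change (zero : C) with (RtoC 0); rewrite Cmod_0; apply Cmod_ge_0. }
  exists (a 1%nat), (a 2%nat), (T3 / s ^ 3), s.
  assert (Hs3 : 0 < s ^ 3) by (apply pow_lt, Hs).
  split; [exact Hs|split; [apply Rdiv_le_0_compat; assumption|]].
  intros w Hw.
  set (h := (w - p)%C) in *.
  pose proof (Ha w ltac:(fold h; unfold s in Hw; lra)) as Hsw; fold h in Hsw.
  assert (Htail : is_series (fun n => pow_n (K := C_Ring) h (3 + n) * a (3 + n)%nat)%C
           (g w - (g p + a 1%nat * h + a 2%nat * (h * h)))%C).
  { apply (is_series_incr_n (V := C_NormedModule) (fun n => pow_n (K := C_Ring) h n * a n)%C 3);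
      [lia|].
    match goal with |- is_series _ ?x => replace x with (g w) end; [exact Hsw|].
    simpl. rewrite !sum_Sn, sum_O; unfold plus; simpl; unfold mult, one; simpl.
    rewrite Ha0; ring. }
  replace (T3 / s ^ 3 * Cmod h ^ 3) with ((Cmod h / s) ^ 3 * T3)
    by (field; lra).
  refine (Cmod_series_le _ _ _ _ Htail
     (is_series_scal (V := R_NormedModule) ((Cmod h / s) ^ 3) _ _ HT3) _).
  intros n.
  change (scal ?x ?y) with (x * y).
  rewrite !Cmod_mult, !Cmod_pow_n, Cs, !pow_add.
  replace ((Cmod h / s) ^ 3 * (s ^ 3 * s ^ n * Cmod (a (3 + n)%nat)))
    with (Cmod h ^ 3 * s ^ n * Cmod (a (3 + n)%nat)) by (field; lra).
  apply Rmult_le_compat_r; [apply Cmod_ge_0|].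
  apply Rmult_le_compat_l; [apply pow_le, Cmod_ge_0|].
  apply pow_incr; split; [apply Cmod_ge_0 | exact Hw].
Qed.

Lemma Cmod_sqr (z : C) : Cmod z ^ 2 = Re z ^ 2 + Im z ^ 2.
Proof. apply pow2_sqrt; apply Rplus_le_le_0_compat; apply pow2_ge_0. Qed.

(** The function [|g|] alone may be constant near [p]; the term
    [eps |w|^2], whose mean over four points around [p] exceeds its value at
    [p] by [eps h^2], makes the four-point mean of the sum strictly larger than
    its value at [p]. *)
Lemma perturbed_modulus_no_interior_max (g : closed_disk -> C) (p : closed_disk) (eps : R) :
  0 < eps -> Cmod p < 1 -> analytic_at g p ->
  exists w : closed_disk,
    Cmod (g p) + eps * Cmod p ^ 2 < Cmod (g w) + eps * Cmod w ^ 2.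
Proof.
  intros Heps Hp Hg.
  destruct (analytic_taylor2 g p Hp Hg) as (a1 & a2 & K & s & Hs & HK & HT).
  apply NNPP; intros Hn.
  assert (Hmax : forall w : closed_disk,
    Cmod (g w) + eps * Cmod w ^ 2 <= Cmod (g p) + eps * Cmod p ^ 2).
  { intros w; apply Rnot_lt_le; intros H; apply Hn; exists w; exact H. }
  assert (He : 0 < eps / (K + 1)) by (apply Rdiv_lt_0_compat; lra).
  (* Were [p] a maximum, the four-point sum would give
     [eps h^2 <= K h^3], which [h <= eps / (K + 1)] rules out. *)
  set (h := Rmin (Rmin s (1 - Cmod p)) (eps / (K + 1))).
  assert (Hh0 : 0 < h) by (repeat apply Rmin_pos; lra).
  assert (Hh1 : h <= s) by (eapply Rle_trans; [apply Rmin_l | apply Rmin_l]).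
  assert (Hh2 : h <= 1 - Cmod p) by (eapply Rle_trans; [apply Rmin_l | apply Rmin_r]).
  assert (Hh3 : h <= eps / (K + 1)) by apply Rmin_r.
  apply Rle_div_r in Hh3; [|lra].
  assert (Hdir : forall d : C, Cmod d = 1 ->
    exists w : closed_disk, exists R : C,
      (w : C) = (p + h * d)%C /\
      (g w = g p + a1 * (h * d) + a2 * ((h * d) * (h * d)) + R)%C /\
      Cmod R <= K * h ^ 3).
  { intros d Hd.
    assert (Chd : Cmod (h * d) = h)
      by (rewrite Cmod_mult, Hd, Cmod_R, Rabs_pos_eq; lra).
    assert (Hw : Cmod (p + h * d) <= 1)
      by (eapply Rle_trans; [apply Cmod_triangle | lra]).
    exists (Closed_disk _ Hw); eexists; split; [reflexivity|].
    specialize (HT (Closed_disk _ Hw)); simpl in HT.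
    replace (p + h * d - p)%C with (h * d)%C in HT by ring.
    rewrite Chd in HT; specialize (HT Hh1).
    split; [|exact HT]; ring. }
  (* The sums of [d] and of [d * d] over these four directions vanish. *)
  destruct (Hdir 1%C) as (w1 & R1 & E1 & G1 & B1); [apply Cmod_1|].
  destruct (Hdir (- (1))%C) as (w2 & R2 & E2 & G2 & B2); [rewrite Cmod_opp; apply Cmod_1|].
  destruct (Hdir Ci) as (w3 & R3 & E3 & G3 & B3); [apply Cmod_Ci|].
  destruct (Hdir (- Ci)%C) as (w4 & R4 & E4 & G4 & B4); [rewrite Cmod_opp; apply Cmod_Ci|].
  pose proof (Hmax w1) as M1; pose proof (Hmax w2) as M2.
  pose proof (Hmax w3) as M3; pose proof (Hmax w4) as M4.
  assert (Hsq : Cmod w1 ^ 2 + Cmod w2 ^ 2 + Cmod w3 ^ 2 + Cmod w4 ^ 2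
                = 4 * Cmod p ^ 2 + 4 * h ^ 2)
    by (rewrite E1, E2, E3, E4, !Cmod_sqr; unfold Re, Im; simpl; ring).
  assert (Hmean : (RtoC 4 * g p = g w1 + g w2 + g w3 + g w4 + (- R1 + - R2 + - R3 + - R4))%C).
  { assert (Ci2 : (Ci * Ci = - (1))%C)
      by (apply injective_projections; simpl; ring).
    replace (RtoC 4) with (1 + 1 + 1 + 1)%C
      by (apply injective_projections; simpl; ring).
    rewrite G1, G2, G3, G4.
    transitivity ((1 + 1 + 1 + 1) * g p + (1 + 1) * (a2 * (h * h) * (1 + Ci * Ci)))%C;
      [rewrite Ci2|]; ring. }
  apply (f_equal Cmod) in Hmean.
  rewrite Cmod_mult, Cmod_R, Rabs_pos_eq in Hmean by lra.
  pose proof (Cmod_triangle (g w1 + g w2 + g w3 + g w4) (- R1 + - R2 + - R3 + - R4)) as T0.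
  pose proof (Cmod_triangle (g w1 + g w2 + g w3) (g w4)) as T1.
  pose proof (Cmod_triangle (g w1 + g w2) (g w3)) as T2.
  pose proof (Cmod_triangle (g w1) (g w2)) as T3.
  pose proof (Cmod_triangle (- R1 + - R2 + - R3) (- R4)) as S1.
  pose proof (Cmod_triangle (- R1 + - R2) (- R3)) as S2.
  pose proof (Cmod_triangle (- R1) (- R2)) as S3.
  rewrite !Cmod_opp in *.
  assert (Hfin : eps * h ^ 2 <= K * h ^ 3) by nra.
  assert (0 < h ^ 2) by (apply pow_lt, Hh0).
  nra.
Qed.

(** A maximum point of [|g| + eps |w|^2] lies on the circle, so
    [|g| <= m + eps] everywhere, for every [eps > 0]. *)
Lemma disk_maximum_principle (g : disk_function) (m : R) :
  (forall z : closed_disk, Cmod z = 1 -> Cmod (g z) <= m) ->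
  forall z, Cmod (g z) <= m.
Proof.
  intros Hb z; apply le_epsilon; intros eps Heps.
  destruct (disk_max_attained (fun w => Cmod (g w) + eps * Cmod w ^ 2)) as [p Hp].
  { intros w; apply (continuous_plus (V := R_NormedModule)).
    - apply continuous_Cmod, disk_fun_continuous.
    - apply (continuous_scal_r (V := R_NormedModule) eps (fun w : closed_disk => Cmod w ^ 2)).
      apply (continuous_comp (fun w : closed_disk => Cmod w) (fun x => x ^ 2)).
      + apply continuous_Cmod, disk_id_continuous.
      + apply (ex_derive_continuous (fun x => x ^ 2)); auto_derive; exact I. }
  destruct (Rle_lt_or_eq_dec _ _ (disk_le1 p)) as [Hlt|Heq].
  - destruct (perturbed_modulus_no_interior_max g p eps Heps Hlt
                (disk_fun_analytic g p Hlt)) as [w Hw].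
    specialize (Hp w); lra.
  - specialize (Hp z); specialize (Hb p Heq); rewrite Heq in Hp.
    pose proof (pow2_ge_0 (Cmod z)); nra.
Qed.

(** * The two directions *)

Lemma Cmod_half (c : C) : Cmod (c / 2) = Cmod c / 2.
Proof.
  assert (H2 : RtoC 2 <> 0%C) by (intros E; apply RtoC_inj in E; lra).
  rewrite Cmod_div, Cmod_R, Rabs_pos_eq by (exact H2 || lra); reflexivity.
Qed.

(** On the circle [|z - z0| >= | |z| - |z0| | = |1 - |z0||]; the maximum
    principle carries the resulting bound on [|g|] to the whole disk. *)
Lemma half_shift_bounded_below (z0 : C) (g : disk_function) :
  Rabs (1 - Cmod z0) / 2 * sup_norm g <= sup_norm (disk_mult (half_shift z0) g).
Proof.
  destruct (Req_dec (Cmod z0) 1) as [E|E].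
  { replace (1 - Cmod z0) with 0 by lra; rewrite Rabs_R0.
    pose proof (sup_norm_ge0 (disk_mult (half_shift z0) g)); lra. }
  assert (Hd : 0 < Rabs (1 - Cmod z0) / 2)
    by (assert (0 < Rabs (1 - Cmod z0)) by (apply Rabs_pos_lt; lra); lra).
  rewrite Rmult_comm; apply Rle_div_r; [exact Hd|].
  apply sup_norm_le, disk_maximum_principle; intros z Hz.
  apply Rle_div_r; [exact Hd|].
  eapply Rle_trans; [|apply (sup_norm_ub (disk_mult (half_shift z0) g) z)].
  simpl; rewrite Cmod_mult, Rmult_comm.
  apply Rmult_le_compat_r; [apply Cmod_ge_0|].
  rewrite Cmod_half.
  apply Rmult_le_compat_r; [lra|].
  rewrite <- Hz; exact (norm_triangle_inv (V := C_NormedModule) (z : C) z0).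
Qed.

(** For [0 <= x <= 1] the sharper bound [1 - x ^ S n] holds: it is
    [1 - x] times the geometric sum [1 + x + ... + x^n], all of whose terms are
    at least [x^n]. *)
Lemma pow_mul_one_minus_le (x : R) (n : nat) :
  0 <= x -> INR (S n) * (x ^ n * (1 - x)) <= 1.
Proof.
  intros Hx.
  destruct (Rle_lt_dec 1 x) as [H1|H1].
  { assert (0 <= INR (S n) * x ^ n) by (apply Rmult_le_pos; [apply pos_INR | apply pow_le, Hx]).
    nra. }
  apply Rle_trans with (1 - x ^ S n).
  (* The induction step amounts to [(1 - x) (1 - x^(n+1)) >= 0]. *)
  - induction n as [|n IH]; [simpl; lra|].
    assert (Hn : 0 <= (1 - x) * (1 - x ^ S n)).
    { apply Rmult_le_pos; [lra|].
      assert (x ^ S n <= 1 ^ S n) by (apply pow_incr; lra).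
      rewrite pow1 in *; lra. }
    apply (Rmult_le_compat_l x) in IH; [|exact Hx].
    rewrite (S_INR (S n)), <- (tech_pow_Rmult x (S n)).
    rewrite <- (tech_pow_Rmult x n) in *; nra.
  - pose proof (pow_le x (S n) Hx); lra.
Qed.

Lemma pow_n_disk (f : disk_algebra) (n : nat) (z : closed_disk) :
  (pow_n f n : disk_function) z = pow_n (K := C_Ring) ((f : disk_function) z) n.
Proof.
  induction n as [|n IH]; [reflexivity|].
  simpl; rewrite IH; reflexivity.
Qed.

(** The parallelogram identity
    [|z - z0|^2 + |z + z0|^2 = 2 |z|^2 + 2 |z0|^2 <= 4] makes
    [half_shift (- z0)] large only where [half_shift z0] is small. *)
Lemma half_shift_parallelogram (z0 : C) (z : closed_disk) :
  Cmod z0 = 1 ->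
  Cmod (half_shift z0 z) ^ 2 + Cmod (half_shift (- z0) z) ^ 2 <= 1.
Proof.
  intros H0.
  pose proof (disk_le1 z) as Hle; pose proof (Cmod_ge_0 z) as Hge.
  assert (Hz : Cmod z ^ 2 <= 1) by nra.
  assert (Hz0 : Cmod z0 ^ 2 = 1) by (rewrite H0; ring).
  simpl; rewrite !Cmod_half.
  replace (_ + _) with ((Cmod (z - z0) ^ 2 + Cmod (z - - z0) ^ 2) / 4) by field.
  rewrite !Cmod_sqr in *; unfold Re, Im in *; simpl in *; lra.
Qed.

Lemma sup_norm_peak_pow (z0 : C) (n : nat) :
  Cmod z0 = 1 -> sup_norm (pow_n (half_shift (- z0)) n : disk_function) = 1.
Proof.
  intros H0; apply Rle_antisym.
  - apply sup_norm_le; intros z.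
    rewrite pow_n_disk, Cmod_pow_n, <- (pow1 n).
    apply pow_incr; split; [apply Cmod_ge_0|].
    pose proof (half_shift_parallelogram z0 z H0).
    pose proof (pow2_ge_0 (Cmod (half_shift z0 z))).
    apply Rnot_lt_le; intros Hlt; nra.
  - assert (Hz : Cmod z0 <= 1) by lra.
    eapply Rle_trans; [|apply (sup_norm_ub _ (Closed_disk z0 Hz))].
    rewrite pow_n_disk, Cmod_pow_n; simpl.
    replace ((z0 - - z0) / 2)%C with z0.
    + rewrite H0, pow1; lra.
    + field.
Qed.

(** With [x = |half_shift z0|] and [y = |half_shift (- z0)|], the square of
    [x y^n] is at most [(1 - y^2) (y^2)^n]. *)
Lemma half_shift_mul_peak_pow_le (z0 : C) (n : nat) :
  Cmod z0 = 1 ->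
  sup_norm (disk_mult (half_shift z0) (pow_n (half_shift (- z0)) n)) <= sqrt (/ INR (S n)).
Proof.
  intros H0; apply sup_norm_le; intros z.
  change (Cmod (half_shift z0 z * (pow_n (half_shift (- z0)) n : disk_function) z) <= sqrt (/ INR (S n))).
  rewrite pow_n_disk, Cmod_mult, Cmod_pow_n.
  pose proof (half_shift_parallelogram z0 z H0) as Hpar.
  set (x := Cmod (half_shift z0 z)) in *; set (y := Cmod (half_shift (- z0) z)) in *.
  assert (Hx : 0 <= x) by apply Cmod_ge_0.
  assert (Hy : 0 <= y) by apply Cmod_ge_0.
  assert (Hyn : 0 <= y ^ n) by (apply pow_le, Hy).
  rewrite <- (sqrt_pow2 (x * y ^ n)) by nra.
  apply sqrt_le_1_alt.
  assert (HS : 0 < INR (S n)) by (apply lt_0_INR; lia).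
  apply Rmult_le_reg_l with (INR (S n)); [exact HS|].
  rewrite Rinv_r by lra.
  eapply Rle_trans; [|apply (pow_mul_one_minus_le (y ^ 2) n), pow2_ge_0].
  apply Rmult_le_compat_l; [lra|].
  rewrite <- pow_mult, Nat.mul_comm, pow_mult.
  assert (0 <= (y ^ n) ^ 2) by apply pow2_ge_0.
  nra.
Qed.

Lemma disk_algebra_lim_zero (u : nat -> disk_algebra) :
  filterlim u eventually (locally (zero : AbsRing_UniformSpace disk_algebra)) <->
  is_lim_seq (fun n => sup_norm (u n : disk_function)) 0.
Proof.
  assert (E : forall f : disk_algebra, abs (minus f zero) = sup_norm (f : disk_function)).
  { intros f; unfold minus; rewrite opp_zero, plus_zero_r; reflexivity. }
  assert (E' : forall f : disk_algebra,
    Rabs (sup_norm (f : disk_function) - 0) = sup_norm (f : disk_function)).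
  { intros f; rewrite Rminus_0_r; apply Rabs_pos_eq, sup_norm_ge0. }
  split; intros H.
  - apply is_lim_seq_spec; intros eps.
    generalize (proj1 (filterlim_locally u (zero : AbsRing_UniformSpace disk_algebra)) H eps).
    apply filter_imp; intros n Hn; rewrite E', <- E; exact Hn.
  - apply (proj2 (filterlim_locally u (zero : AbsRing_UniformSpace disk_algebra))).
    intros eps; generalize (proj2 (is_lim_seq_spec _ _) H eps).
    apply filter_imp; intros n Hn; rewrite E', <- E in Hn; exact Hn.
Qed.

Lemma disk_mult_comm (f g : disk_function) : disk_mult f g = disk_mult g f.
Proof. apply disk_function_ext; intros z; simpl; ring. Qed.

Theorem theorem4p1 (z0 : C) :
  topological_divisor_of_zero (half_shift z0) <-> Cmod z0 = 1.
Proof.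
  split.
  - intros (zn & Hnorm & Hlim).
    assert (Hlim' : filterlim (fun n => mult (half_shift z0) (zn n)) eventually
              (locally (zero : AbsRing_UniformSpace disk_algebra))).
    { destruct Hlim as [H|H]; [exact H|].
      eapply filterlim_ext; [|exact H].
      intros n; apply disk_mult_comm. }
    apply disk_algebra_lim_zero in Hlim'.
    assert (Hle : Rbar_le (Rabs (1 - Cmod z0) / 2) 0).
    { refine (is_lim_seq_le _ _ _ _ _ (is_lim_seq_const _) Hlim').
      intros n.
      pose proof (half_shift_bounded_below z0 (zn n)) as Hb.
      change (sup_norm (zn n : disk_function)) with (abs (zn n)) in Hb.
      rewrite Hnorm, Rmult_1_r in Hb; exact Hb. }
    simpl in Hle.
    apply NNPP; intros Hne.
    assert (0 < Rabs (1 - Cmod z0)) by (apply Rabs_pos_lt; lra).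
    lra.
  - intros H0.
    exists (fun n => pow_n (half_shift (- z0)) n); split.
    + intros n; exact (sup_norm_peak_pow z0 n H0).
    + left; apply disk_algebra_lim_zero.
      refine (is_lim_seq_le_le (fun _ => 0) _ (fun n => sqrt (/ INR (S n))) 0 _
                (is_lim_seq_const 0) _).
      * intros n; split; [apply sup_norm_ge0|].
        exact (half_shift_mul_peak_pow_le z0 n H0).
      * rewrite <- sqrt_0.
        apply (is_lim_seq_continuous sqrt (fun n => / INR (S n)) 0).
        { apply continuity_pt_sqrt; lra. }
        apply (is_lim_seq_inv (fun n => INR (S n)) p_infty); [|discriminate].
        apply (is_lim_seq_incr_1 INR), is_lim_seq_INR.
Qed.
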